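(* Let $(X,d)$ be a metric space, let $\mathcal{R}\subset C(\mathbb{R}_+;X)$ satisfy (K1), (K2), (K3) and $(\overline{K}4)$, and assume that the associated m-semiflow $G$ has a compact global attractor $\mathcal{A}$. Let $\mathcal{S}=\{\Xi_1,\ldots,\Xi_n\}$, $\Xi_i\subset\mathcal{A}$, be a disjoint family of isolated weakly invariant sets. Then $G$ is dynamically gradient with respect to $\mathcal{S}$ (i.e. (G1) and (G2) hold) if and only if $\mathcal{S}$ can be reordered in such a way that any bounded complete trajectory $\gamma(\cdot)$ of $\mathcal{R}$ satisfies one of the following properties: 1. $\{\gamma(t):t\in\mathbb{R}\}\subset\Xi_i$ for some $i$. 2. There are $i<j$ for which $\gamma(t)\to\Xi_i$ as $t\to\infty$ and $\gamma(t)\to\Xi_j$ as $t\to-\infty$.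
   Context: Let $(X,d)$ be a metric space, $P(X)$ the class of nonempty subsets of $X$, and $dist_X(A,B)=\sup_{a\in A}\inf_{b\in B}d(a,b)$; for a point $x$, $dist_X(x,B)=dist_X(\{x\},B)$. The notation $\gamma(t)\to\Xi$ means $dist_X(\gamma(t),\Xi)\to0$. For a family $\mathcal{R}\subset C(\mathbb{R}_+;X)$ consider the properties: (K1) For any $x\in X$ there is $\varphi\in\mathcal{R}$ with $\varphi(0)=x$. (K2) $\varphi(\cdot+\tau)\in\mathcal{R}$ for all $\tau\ge0$, $\varphi\in\mathcal{R}$. (K3) If $\varphi_1,\varphi_2\in\mathcal{R}$ and $\varphi_2(0)=\varphi_1(s)$ for some $s>0$, then the function equal to $\varphi_1(t)$ for $0\le t\le s$ and to $\varphi_2(t-s)$ for $t\ge s$ belongs to $\mathcal{R}$. $(\overline{K}4)$ For any sequence $\{\varphi^n\}\subset\mathcal{R}$ with $\varphi^n(0)\to\varphi_0$ in $X$ there are a subsequence and $\varphi\in\mathcal{R}$ such that the subsequence converges to $\varphi$ uniformly on bounded subsets of $[0,\infty)$. The associated m-semiflow is $G:\mathbb{R}_+\times X\to P(X)$, $G(t,x)=\{u(t):u\in\mathcal{R},\,u(0)=x\}$. A complete trajectory of $\mathcal{R}$ is a map $\gamma:\mathbb{R}\to X$ such that $\gamma(\cdot+h)|_{[0,\infty)}\in\mathcal{R}$ for all $h\in\mathbb{R}$. A set $B\subset X$ is weakly invariant if for every $x\in B$ there is a complete trajectory $\gamma$ of $\mathcal{R}$ contained in $B$ with $\gamma(0)=x$.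 A set $\mathcal{A}\subset X$ is a global attractor for $G$ if $\mathcal{A}\subset G(t,\mathcal{A})$ for all $t\ge0$ and $dist_X(G(t,B),\mathcal{A})\to0$ as $t\to\infty$ for every bounded $B\subset X$. Isolated family: $\mathcal{S}=\{\Xi_1,\ldots,\Xi_n\}$ is a family of isolated weakly invariant sets if there is $\delta>0$ such that, with $\mathcal{O}_\delta(\Xi_i)=\{x\in X: dist_X(x,\Xi_i)<\delta\}$, one has $\mathcal{O}_\delta(\Xi_i)\cap\mathcal{O}_\delta(\Xi_j)=\emptyset$ for $i<j$, and each $\Xi_i$ is the maximal weakly invariant subset of $\mathcal{O}_\delta(\Xi_i)$. Homoclinic orbit: a homoclinic orbit in $\mathcal{A}$ is a collection $\{\Xi_{p(1)},\ldots,\Xi_{p(k)}\}\subset\mathcal{S}$ together with complete trajectories $\gamma_1,\dots,\gamma_k$ of $\mathcal{R}$ in $\mathcal{A}$ such that (with $p(k+1):=p(1)$) $\lim_{t\to-\infty}dist_X(\gamma_i(t),\Xi_{p(i)})=0$ and $\lim_{t\to\infty}dist_X(\gamma_i(t),\Xi_{p(i+1)})=0$ for $1\le i\le k$, and for each $i$ there is $t_i\in\mathbb{R}$ with $\gamma_i(t_i)\notin\Xi_{p(i)}\cup\Xi_{p(i+1)}$. Dynamically gradient: $G$ with global attractor $\mathcal{A}$ is dynamically gradient with respect to a finite family $\mathcal{S}=\{\Xi_1,\ldots,\Xi_n\}$ of isolated weakly invariant sets in $\mathcal{A}$ if (G1) every complete trajectory $\gamma$ of $\mathcal{R}$ in $\mathcal{A}$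 satisfies $\lim_{t\to-\infty}dist_X(\gamma(t),\Xi_i)=0$ and $\lim_{t\to\infty}dist_X(\gamma(t),\Xi_j)=0$ for some $1\le i,j\le n$; and (G2) $\mathcal{S}$ does not contain homoclinic orbits. *)

(* Defs.v *)
From HB Require Import structures.
From mathcomp Require Import all_boot all_order all_algebra all_fingroup.
From mathcomp Require Import all_classical all_reals all_analysis.
Import Order.TTheory GRing.Theory Num.Theory.
Import numFieldNormedType.Exports.

Set Implicit Arguments.
Unset Strict Implicit.
Unset Printing Implicit Defensive.

Local Open Scope classical_set_scope.
Local Open Scope ring_scope.

(* [0, +oo[ as a type, with the subspace topology of R. *)
Notation Rplus R := (set_type [set t : R | 0 <= t]).

Lemma max0_ge0 (R : realType) (t : R) : [set s : R | 0 <= s] (Num.max 0 t).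
Proof. by rewrite /= le_max lexx. Qed.

(* The positive part of t. It is only used where 0 <= t, or eventually as
   t --> +oo, so that to_Rplus t is just t seen in [0, +oo[. *)
Definition to_Rplus (R : realType) (t : R) : Rplus R :=
  SigSub (mem_set (max0_ge0 t)).

Section Distance.
Context {R : realType} {X : metricType R}.

(* Extended-real valued, because the supremum may be infinite. The two
   degenerate cases are hdist set0 B = -oo, and hdist A set0 = +oo for A
   nonempty. *)
Definition hdist (A B : set X) : \bar R :=
  ereal_sup [set ereal_inf [set (mdist a b)%:E | b in B] | a in A].

Definition tends_to (g : R -> X) (F : set_system R) (Xi : set X) : Prop :=
  hdist [set g t] Xi @[t --> F] --> 0%E.

Definition nbhd_of (delta : R) (Xi : set X) : set X :=
  [set x | (hdist [set x] Xi < delta%:E)%E].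

Definition metric_bounded (B : set X) : Prop :=
  exists M : R, forall x y, B x -> B y -> mdist x y <= M.

End Distance.

Section Semiflow.
Context {R : realType} {X : metricType R}.
Implicit Types (K : set (Rplus R -> X)) (A B : set X).

Definition shift (tau : Rplus R) (phi : Rplus R -> X) : Rplus R -> X :=
  fun t => phi (to_Rplus (\val t + \val tau)).

Definition concat (s : Rplus R) (phi1 phi2 : Rplus R -> X) : Rplus R -> X :=
  fun t => if \val t <= \val s then phi1 t
           else phi2 (to_Rplus (\val t - \val s)).

Definition K1 K : Prop :=
  forall x : X, exists2 phi, K phi & phi (to_Rplus 0) = x.

Definition K2 K : Prop := forall tau phi, K phi -> K (shift tau phi).

Definition K3 K : Prop := forall phi1 phi2 (s : Rplus R),
  K phi1 -> K phi2 -> 0 < \val s -> phi2 (to_Rplus 0) = phi1 s ->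
  K (concat s phi1 phi2).

Definition K4bar K : Prop := forall (phi : nat -> Rplus R -> X) (phi0 : X),
  (forall n, K (phi n)) ->
  phi n (to_Rplus 0) @[n --> \oo] --> phi0 ->
  exists (e : nat -> nat) (psi : Rplus R -> X),
    [/\ increasing_seq e, K psi &
      forall B : set (Rplus R), bounded_set [set \val t | t in B] ->
        {uniform B, phi (e n) @[n --> \oo] --> psi}].

Definition msemiflow K (t : Rplus R) (x : X) : set X :=
  [set u t | u in [set u | K u /\ u (to_Rplus 0) = x]].

Definition msemiflow_set K (t : Rplus R) (B : set X) : set X :=
  \bigcup_(x in B) msemiflow K t x.

Definition complete_trajectory K (g : R -> X) : Prop :=
  forall h : R, K (fun t : Rplus R => g (\val t + h)).

Definition weakly_invariant K B : Prop :=
  forall x, B x ->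
    exists g, [/\ complete_trajectory K g, range g `<=` B & g 0 = x].

(* Attraction is required of nonempty bounded sets only, hdist being meant for
   nonempty sets: hdist set0 A = -oo does not tend to 0. *)
Definition global_attractor K A : Prop :=
  (forall t, A `<=` msemiflow_set K t A) /\
  (forall B, B !=set0 -> metric_bounded B ->
    hdist (msemiflow_set K (to_Rplus t) B) A @[t --> +oo] --> 0%E).

Section Family.
Variables (K : set (Rplus R -> X)) (A : set X).
Context {n : nat}.
Implicit Type Xi : 'I_n -> set X.

Definition isolated_family Xi : Prop :=
  exists2 delta : R, 0 < delta &
    (forall i j : 'I_n, (i < j)%N ->
       nbhd_of delta (Xi i) `&` nbhd_of delta (Xi j) = set0) /\
    (forall i, [/\ weakly_invariant K (Xi i),
       Xi i `<=` nbhd_of delta (Xi i) &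
       forall B, weakly_invariant K B -> B `<=` nbhd_of delta (Xi i) ->
         B `<=` Xi i]).

(* The collection is indexed by 'I_k.+1 (k + 1 >= 1 sets), and the cyclic
   successor ordS gives the convention that the last set is followed by the
   first. *)
Definition homoclinic_orbit Xi (k : nat) (p : 'I_k.+1 -> 'I_n)
    (g : 'I_k.+1 -> R -> X) : Prop :=
  forall i, [/\ complete_trajectory K (g i),
    range (g i) `<=` A,
    tends_to (g i) -oo (Xi (p i)),
    tends_to (g i) +oo (Xi (p (ordS i))) &
    exists t, ~ (Xi (p i) `|` Xi (p (ordS i))) (g i t)].

Definition G1 Xi : Prop := forall g, complete_trajectory K g ->
  range g `<=` A ->
  exists i j, tends_to g -oo (Xi i) /\ tends_to g +oo (Xi j).

Definition G2 Xi : Prop :=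
  ~ exists (k : nat) (p : 'I_k.+1 -> 'I_n) (g : 'I_k.+1 -> R -> X),
      homoclinic_orbit Xi p g.

Definition dynamically_gradient Xi : Prop := G1 Xi /\ G2 Xi.

End Family.
End Semiflow.

(* Main.v *)
Require Import Defs.
From HB Require Import structures.
From mathcomp Require Import all_boot all_order all_algebra all_fingroup.
From mathcomp Require Import all_classical all_reals all_analysis.
Import Order.TTheory GRing.Theory Num.Theory.
Import numFieldNormedType.Exports.

Set Implicit Arguments.
Unset Strict Implicit.
Unset Printing Implicit Defensive.

Local Open Scope classical_set_scope.
Local Open Scope ring_scope.

(** Consider the directed graph on the indices with an arrow i -> j whenever
    some complete trajectory in the attractor leaves [Xi i] at -oo, reaches
    [Xi j] at +oo and visits a point outside [Xi i `|` Xi j]. Condition (G2)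
    says exactly that this graph has no cycle, loops included.

    If the family is dynamically gradient, the acyclic graph can therefore be
    numbered so that indices decrease along arrows ([acyclic_perm]). A bounded
    complete trajectory g lies in the attractor, because each g t is reached
    from the bounded set [range g] after an arbitrarily long time
    ([bounded_complete_trajectory_sub]), so (G1) gives it limit sets [Xi i] at
    -oo and [Xi j] at +oo. Either it has a point outside their union, and then
    it is an arrow, or its range, being connected, lies in a single one of
    these two sets, which have disjoint open neighborhoods
    ([range_sub_union]).

    Conversely, trajectories in the compact attractor are bounded, so an
    ordering with the stated property gives (G1) at once. Limit sets are unique
    ([tends_to_unique]); hence on a homoclinic cycle no trajectory stays in one
    set of the family, and the rank of the limit set would decrease strictly
    all around the cycle ([no_cyclic_descent]). *)

(** * Numbering a finite acyclic graph *)

Lemma sorting_perm (n : nat) (f : 'I_n -> nat) :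
  exists sigma : {perm 'I_n},
    forall i j, (f (sigma i) < f (sigma j))%N -> (i < j)%N.
Proof.
pose s := sort (relpre f leq) (enum 'I_n).
have size_s : size s = n by rewrite size_sort size_enum_ord.
have uniq_s : uniq s by rewrite sort_uniq enum_uniq.
have sorted_s : sorted (relpre f leq) s.
  by apply: sort_sorted => i j; exact: leq_total.
pose h (i : 'I_n) := nth i s i.
(* Both sides of an equation h i = h j need a common default for nth. *)
have hE (d i : 'I_n) : h i = nth d s i.
  by apply: set_nth_default; rewrite size_s.
have h_inj : injective h.
  move=> i j; rewrite (hE i i) (hE i j) => /eqP.
  by rewrite nth_uniq ?size_s// => /eqP/val_inj.
exists (perm h_inj) => i j; rewrite !permE; apply: contraTltn => le_ji.
rewrite -leqNgt (hE i j) (hE i i).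
have := @sorted_leq_nth _ (relpre f leq) _ _ i s sorted_s j i.
rewrite !inE size_s; apply => //.
- by move=> x y z; exact: leq_trans.
- by move=> x /=.
Qed.

Lemma no_cyclic_descent (k : nat) (r : 'I_k.+1 -> nat) :
  ~ forall i, (r (ordS i) < r i)%N.
Proof.
move=> desc; case: (@arg_minnP _ ord0 predT r isT) => i _ /(_ (ordS i) isT).
by rewrite leqNgt desc.
Qed.

(** The vertices are sorted by number of descendants. An arrow from x to y makes
    every descendant of y a descendant of x, while x itself descends from y
    only if there is a cycle: so the number decreases strictly along arrows. *)
Lemma acyclic_perm (n : nat) (e : rel 'I_n) :
  (forall (k : nat) (p : 'I_k.+1 -> 'I_n),
     ~ forall i, e (p i) (p (ordS i))) ->
  exists sigma : {perm 'I_n},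
    forall i j, e (sigma j) (sigma i) -> (i < j)%N.
Proof.
move=> acyclic.
have [sigma sigmaP] := sorting_perm (fun i => #|connect e i|).
exists sigma => i j e_ji; apply: sigmaP; apply: proper_card.
apply/properP; split.
  by apply/fintype.subsetP => x; apply: connect_trans; exact: connect1.
exists (sigma j); first exact: connect0.
apply/negP => /connectP[p path_p last_p].
(* The path p from sigma i to sigma j closes up with the arrow back to
   sigma i; its vertices, read cyclically, contradict acyclicity. *)
pose s := sigma i :: p.
have cyc m : (m < size s)%N ->
    e (nth (sigma i) s m) (nth (sigma i) s (m.+1 %% size s)).
  rewrite /= ltnS leq_eqVlt => /predU1P[->|m_lt].
    by rewrite modnn/= (nth_last (sigma i) s)/= -last_p.
  rewrite modn_small ?ltnS//.
  exact: (pathP (sigma i) path_p).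
apply: (acyclic (size p) (fun m => nth (sigma i) s m)) => m.
exact: cyc.
Qed.

(** * Distance to a set *)

Section MetricDistance.
Context {R : realType} {X : metricType R}.
Implicit Types (x : X) (A B : set X).

Lemma hdist_pt x B :
  hdist [set x] B = ereal_inf [set (mdist x b)%:E | b in B].
Proof. by rewrite /hdist image_set1 ereal_sup1. Qed.

Lemma hdist_pt_mem x B : B x -> hdist [set x] B = 0%E.
Proof.
move=> Bx; rewrite hdist_pt; apply/eqP; rewrite eq_le; apply/andP; split.
  by apply: ereal_inf_lbound; exists x => //; rewrite mdistxx.
by apply/ereal_infP => _ [b _ <-]; rewrite lee_fin mdist_ge0.
Qed.

Lemma nbhd_ofP (delta : R) B x :
  nbhd_of delta B x <-> exists2 b, B b & mdist x b < delta.
Proof.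
rewrite /nbhd_of/= hdist_pt; split.
  by move=> /ereal_inf_lt[_ [b Bb <-]]; rewrite lte_fin; exists b.
move=> [b Bb ltd]; apply: (@le_lt_trans _ _ (mdist x b)%:E).
  by apply: ereal_inf_lbound; exists b.
by rewrite lte_fin.
Qed.

Lemma sub_nbhd_of (delta : R) B : 0 < delta -> B `<=` nbhd_of delta B.
Proof. by move=> d0 x Bx; apply/nbhd_ofP; exists x; rewrite ?mdistxx. Qed.

Lemma open_nbhd_of (delta : R) B : open (nbhd_of delta B).
Proof.
rewrite openE => x /nbhd_ofP[b Bb ltd]; apply/nbhs_ballP.
exists (delta - mdist x b) => /=; first by rewrite subr_gt0.
move=> y; rewrite ballEmdist/= => lty; apply/nbhd_ofP; exists b => //.
rewrite (le_lt_trans (metric_triangle y x b))// metric_sym.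
by rewrite -ltrBrDr.
Qed.

Lemma closure_hdist x A : (hdist [set x] A <= 0)%E -> closure A x.
Proof.
move=> le0 B /nbhs_ballP[e /= e0 eB].
have /nbhd_ofP[a Aa lta] : nbhd_of e A x.
  by apply: (le_lt_trans le0); rewrite lte_fin.
by exists a; split => //; apply: eB; rewrite ballEmdist.
Qed.

Lemma le_hdist_pt x A B : A x -> (hdist [set x] B <= hdist A B)%E.
Proof.
by move=> Ax; apply: ereal_sup_le => _ [_ -> <-]; exists x.
Qed.

Lemma compact_metric_bounded A : compact A -> metric_bounded A.
Proof.
have [[x0 _]|/nonemptyPn->] := pselect (A !=set0); last by exists 0.
move=> cA.
have cont : continuous (mdist x0 : X -> R).
  move=> x; apply/cvgrPdist_lt => e e0; near=> y.
  have : ball x e y by near: y; exact: nbhsx_ballx.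
  rewrite ballEmdist/= => xy; apply: le_lt_trans xy.
  rewrite ler_norml lerNl opprB !lerBlDr; apply/andP; split; rewrite addrC.
    exact: metric_triangle.
  by rewrite [X in _ <= _ + X]metric_sym metric_triangle.
have : compact (mdist x0 @` A).
  by apply: continuous_compact => //; exact: continuous_subspaceT.
move=> /compact_bounded[M [_ /(_ (M + 1))]]; rewrite ltrDl ltr01 => /(_ isT) HM.
have bnd x : A x -> mdist x0 x <= M + 1.
  by move=> Ax; apply: le_trans (ler_norm _) _; apply: HM; exists x.
exists ((M + 1) + (M + 1)) => x y Ax Ay.
by rewrite (le_trans (metric_triangle x x0 y))// lerD// ?bnd// metric_sym bnd.
Unshelve. all: by end_near. Qed.

Lemma metric_bounded_sub A B : A `<=` B -> metric_bounded B -> metric_bounded A.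
Proof. by move=> AB [M BM]; exists M => x y /AB Bx /AB; exact: BM. Qed.

Lemma tends_to_near (g : R -> X) (F : set_system R) {FF : Filter F}
    (delta : R) B : 0 < delta -> tends_to g F B ->
  \forall t \near F, nbhd_of delta B (g t).
Proof.
move=> d0 gB; have : nbhs 0%E [set u : \bar R | (u < delta%:E)%E].
  by apply: open_ereal_lt'; rewrite lte_fin.
by move=> /gB.
Qed.

Lemma tends_to_mem (g : R -> X) (F : set_system R) {FF : Filter F} B :
  range g `<=` B -> tends_to g F B.
Proof.
move=> gB; apply: cvg_near_cst; apply: nearW => t.
by apply: hdist_pt_mem; apply: gB; exists t.
Qed.

End MetricDistance.

Lemma connected_sub_disjoint_open (T : topologicalType) (C U V : set T) :
  connected C -> open U -> open V -> U `&` V = set0 -> C `<=` U `|` V ->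
  C `<=` U \/ C `<=` V.
Proof.
move=> conC oU oV UV0 CUV.
have [CU0|/nonemptyPn CU0] := pselect ((C `&` U) !=set0); [left|right].
  have <- : C `&` U = C; last by move=> x [].
  apply: conC => //; first by exists U.
  exists (~` V); first exact: open_closedC.
  apply/seteqP; split => [x [Cx Ux]|x [Cx nVx]].
    by split => // Vx; have : (U `&` V) x by []; rewrite UV0.
  by split => //; case: (CUV _ Cx).
move=> x Cx; case: (CUV x Cx) => // Ux.
by have : (C `&` U) x by []; rewrite CU0.
Qed.

(** * Complete trajectories *)

Section CompleteTrajectory.
Context {R : realType} {X : metricType R}.
Implicit Types (K : set (Rplus R -> X)) (A : set X) (g : R -> X).

Lemma to_RplusE (t : R) : 0 <= t -> \val (to_Rplus t) = t.
Proof. by move=> t0 /=; exact: max_r. Qed.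

Lemma continuous_to_Rplus : continuous (@to_Rplus R).
Proof.
apply: continuous_comp_initial => t.
apply: continuous_max; [exact: cvg_cst|exact: cvg_id].
Qed.

(** Membership in K controls g only on half-lines [h, +oo[, where continuity is
    one-sided at h. Two-sided continuity at t0 comes from starting earlier, at
    h = t0 - 1. *)
Lemma complete_trajectory_continuous K g :
  (forall phi, K phi -> continuous phi) -> complete_trajectory K g ->
  continuous g.
Proof.
move=> Kcont gK t0.
have Kg := Kcont _ (gK (t0 - 1)).
pose f t := g (\val (to_Rplus (t - (t0 - 1))) + (t0 - 1)).
have fE t : t0 - 1 <= t -> f t = g t.
  by move=> le_t; rewrite /f to_RplusE ?subr_ge0// subrK.
have cf : {for t0, continuous f}.
  apply: (@continuous_comp _ _ _ (fun t => to_Rplus (t - (t0 - 1)))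
    (fun s : Rplus R => g (\val s + (t0 - 1)))); last exact: Kg.
  apply: (@continuous_comp _ _ _ (fun t : R => t - (t0 - 1)) (@to_Rplus R)).
    by apply: cvgB; [exact: cvg_id|exact: cvg_cst].
  exact: continuous_to_Rplus.
rewrite /continuous_at -fE ?lerBlDr ?lerDl//.
apply: cvg_trans cf; apply: near_eq_cvg; near=> t.
apply: fE; apply: ltW; near: t; apply: lt_nbhsr.
by rewrite ltrBlDr ltrDl.
Unshelve. all: by end_near. Qed.

(** Starting at time t - s from the point [g (t - s)] of [range g], the
    trajectory is at [g t] after time s. Hence the distance from [g t] to A is at most that
    of the image of [range g] at time s, which tends to 0 as s grows. *)
Lemma bounded_complete_trajectory_sub K A g :
  global_attractor K A -> closed A ->
  complete_trajectory K g -> metric_bounded (range g) -> range g `<=` A.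
Proof.
move=> [_ attr] clA gK gbnd _ [t _ <-].
have g_gt (s : R) : 0 <= s -> msemiflow_set K (to_Rplus s) (range g) (g t).
  move=> s0; exists (g (t - s)); first by exists (t - s).
  exists (fun u : Rplus R => g (\val u + (t - s))).
    by split; [exact: gK|rewrite to_RplusE// add0r].
  by rewrite to_RplusE// addrC subrK.
apply: clA; apply: closure_hdist.
have rg0 : range g !=set0 by exists (g t), t.
apply: (cvge_ge _ (attr _ rg0 gbnd)); near=> s.
by apply: le_hdist_pt; apply: g_gt; near: s; exact: nbhs_pinfty_ge.
Unshelve. all: by end_near. Qed.

End CompleteTrajectory.

(** * Limit sets in an isolated family *)

Section IsolatedFamily.
Context {R : realType} {X : metricType R} (K : set (Rplus R -> X)) {n : nat}.
Variable Xi : 'I_n -> set X.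
Hypothesis Xiisol : isolated_family K Xi.

Lemma isolated_neighborhoods :
  exists2 delta : R, 0 < delta & forall i j, i != j ->
    nbhd_of delta (Xi i) `&` nbhd_of delta (Xi j) = set0.
Proof.
have [delta d0 [disj _]] := Xiisol; exists delta => // i j.
by case: (ltngtP i j) => [/disj//|/disj + _|/val_inj->]; rewrite ?eqxx// setIC.
Qed.

Lemma tends_to_unique (g : R -> X) (F : set_system R) {FF : ProperFilter F} i j :
  tends_to g F (Xi i) -> tends_to g F (Xi j) -> i = j.
Proof.
have [delta d0 disj] := isolated_neighborhoods => gi gj.
apply/eqP/negPn/negP => /disj ij0.
have [t []] := filter_ex
  (filterI (tends_to_near d0 gi) (tends_to_near d0 gj)).
by move=> gti gtj; have : set0 (g t) by rewrite -ij0.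
Qed.

(** The disjoint open neighborhoods of [Xi i] and [Xi j] disconnect their union,
    so the range of g, being connected, stays on one side. *)
Lemma range_sub_union (g : R -> X) i j : continuous g ->
  range g `<=` Xi i `|` Xi j -> range g `<=` Xi i \/ range g `<=` Xi j.
Proof.
have [->|neq_ij] := eqVneq i j; first by rewrite setUid; left.
have [delta d0 disj] := isolated_neighborhoods.
move=> cg gij.
have con : connected (range g).
  apply: connected_continuous_connected; last exact: continuous_subspaceT.
  exact/connected_intervalP.
have sub k := @sub_nbhd_of _ _ _ (Xi k) d0.
have := connected_sub_disjoint_open con (@open_nbhd_of _ _ delta (Xi i))
  (@open_nbhd_of _ _ delta (Xi j)) (disj _ _ neq_ij).
have disjP x : nbhd_of delta (Xi i) x -> nbhd_of delta (Xi j) x -> False.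
  by move=> ix jx; have : set0 x by rewrite -(disj _ _ neq_ij).
case=> [x /gij[/sub|/sub]|gU|gU]; [by left|by right|left|right] => x gx;
  case: (gij x gx) => // /sub Ux.
  exact: (False_ind _ (disjP x (gU x gx) Ux)).
exact: (False_ind _ (disjP x Ux (gU x gx))).
Qed.

End IsolatedFamily.

Theorem theorem20 (R : realType) (X : metricType R)
    (K : set (Rplus R -> X)) (A : set X) (n : nat) (Xi : 'I_n -> set X)
    (Kcont : forall phi, K phi -> continuous phi)
    (hK1 : K1 K) (hK2 : K2 K) (hK3 : K3 K) (hK4 : K4bar K)
    (Aattr : global_attractor K A) (Acomp : compact A)
    (XiA : forall i, Xi i `<=` A)
    (Xidisj : trivIset setT Xi)
    (Xiisol : isolated_family K Xi) :
  dynamically_gradient K A Xi <->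
  exists sigma : {perm 'I_n},
    forall g : R -> X, complete_trajectory K g -> metric_bounded (range g) ->
      (exists i : 'I_n, range g `<=` Xi (sigma i)) \/
      (exists i j : 'I_n, [/\ (i < j)%N,
         tends_to g +oo (Xi (sigma i)) & tends_to g -oo (Xi (sigma j))]).
Proof.
have clA : closed A by apply: compact_closed => //; exact: metric_hausdorff.
split=> [[hG1 hG2]|[sigma ordered]].
  pose conn i j (g : R -> X) := [/\ complete_trajectory K g, range g `<=` A,
    tends_to g -oo (Xi i), tends_to g +oo (Xi j) &
    exists t, ~ (Xi i `|` Xi j) (g t)].
  pose e : rel 'I_n := fun i j => `[< exists g, conn i j g >].
  have [k p pe|sigma sigmaP] := @acyclic_perm n e.
    have /choice[g gP] : forall i, exists g, conn (p i) (p (ordS i)) g.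
      by move=> i; have /asboolP := pe i.
    by apply: hG2; exists k, p, g.
  exists sigma => g gK gbnd.
  have gA := bounded_complete_trajectory_sub Aattr clA gK gbnd.
  have [i [j [gi gj]]] := hG1 g gK gA.
  have onto k : sigma ((sigma^-1)%g k) = k by rewrite permKV.
  have [gij|out] := pselect (range g `<=` Xi i `|` Xi j).
    left; have cg := complete_trajectory_continuous Kcont gK.
    have [gin|gin] := range_sub_union Xiisol cg gij.
      by exists ((sigma^-1)%g i); rewrite onto.
    by exists ((sigma^-1)%g j); rewrite onto.
  right; exists ((sigma^-1)%g j), ((sigma^-1)%g i).
  rewrite !onto; split => //.
  apply: sigmaP; rewrite !onto; apply/asboolP; exists g; split => //.
  by move/existsNP: out => [_ /not_implyP[[t _ <-] nt]]; exists t.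
have bnd (g : R -> X) : range g `<=` A -> metric_bounded (range g).
  by move=> gA; apply: metric_bounded_sub gA _; exact: compact_metric_bounded.
split.
  move=> g gK gA; have [[i gi]|[i [j [_ gi gj]]]] := ordered g gK (bnd g gA).
    by exists (sigma i), (sigma i); split; apply: tends_to_mem.
  by exists (sigma j), (sigma i).
move=> [k [p [g homo]]].
apply: (@no_cyclic_descent k (fun i => (sigma^-1)%g (p i))) => i.
have [gK gA gm gp [t nt]] := homo i.
have [[l gl]|[a [b [lt_ab ga gb]]]] := ordered _ gK (bnd _ gA).
  have pl : p i = sigma l.
    by apply: (tends_to_unique Xiisol gm); exact: tends_to_mem.
  by exfalso; apply: nt; left; rewrite pl; apply: gl; exists t.
rewrite (tends_to_unique Xiisol gm gb) (tends_to_unique Xiisol gp ga).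
by rewrite !permK.
Qed.
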